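(* Let $R$ be a commutative ring with unity, let $\varphi:\mathcal{C}\to\mathcal{D}$ be a functor between small categories, and let $M:\Delta(N\mathcal{D})\to R\text{-Mod}$ be any coefficient system on $N\mathcal{D}$. Suppose that for each object $d$ of $\mathcal{D}$ the homomorphism $$u^*:H^*_{Th}(\mathrm{id}_{\mathcal{D}}/d;\,j^*M)\to H^*_{Th}(\varphi/d;\,j^*\varphi^*M)$$ is an isomorphism. Then $\varphi$ induces an isomorphism $$\varphi^*:H^*_{Th}(\mathcal{D};M)\to H^*_{Th}(\mathcal{C};\varphi^*M).$$
   Context: For a simplicial set $X$, the category of simplices $\Delta(X)$ has objects $([n],\sigma)$ with $\sigma\in X_n$ (written simply $\sigma$), and morphisms $([m],\tau)\to([n],\sigma)$ are the morphisms $f:[m]\to[n]$ of the simplex category $\Delta$ with $f^*\sigma=\tau$. A coefficient system on $X$ is a functor $M:\Delta(X)\to R\text{-Mod}$. Let $C(X;M)$ be the cosimplicial $R$-module with $C^n(X;M)=\prod_{\sigma\in X_n}M(\sigma)$ and, for $f:[m]\to[n]$, $(f^*\zeta)(\sigma)=M(f)(\zeta(f^*\sigma))$. The Gabriel-Zisman cohomology $H^\bullet(X;M)$ is the cohomology of $C(X;M)$, i.e. of the cochain complex with differential the alternating sum of the coface maps. For a small category $\mathcal{C}$ and a coefficient system $M$ on its nerve $N\mathcal{C}$, the Thomason cohomology is $H^\bullet_{Th}(\mathcal{C};M):=H^\bullet(N\mathcal{C};M)$. A functor $\psi:\mathcal{A}\to\mathcal{B}$ induces a simplicial map $N\psi:N\mathcal{A}\to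 N\mathcal{B}$ and hence a functor $\Delta(N\psi):\Delta(N\mathcal{A})\to\Delta(N\mathcal{B})$; for a coefficient system $M$ on $N\mathcal{B}$ put $\psi^*M=M\circ\Delta(N\psi)$. The cochain map $(\psi^*\zeta)(\sigma)=\zeta(N\psi(\sigma))$ induces $\psi^*:H^\bullet_{Th}(\mathcal{B};M)\to H^\bullet_{Th}(\mathcal{A};\psi^*M)$. For an object $d$ of $\mathcal{D}$, $\varphi/d$ is the comma category with objects $(c,\mu:\varphi(c)\to d)$ and morphisms $(c,\mu)\to(c',\mu')$ the $\alpha:c\to c'$ in $\mathcal{C}$ with $\mu'\varphi(\alpha)=\mu$; $\mathrm{id}_{\mathcal{D}}/d$ is the same construction for the identity functor of $\mathcal{D}$. The functor $j:\varphi/d\to\mathcal{C}$ is $(c,\mu)\mapsto c$, similarly $j:\mathrm{id}_{\mathcal{D}}/d\to\mathcal{D}$ is $(d',\mu)\mapsto d'$, and $u:\varphi/d\to\mathrm{id}_{\mathcal{D}}/d$ is $(c,\mu)\mapsto(\varphi(c),\mu)$ (on morphisms $\alpha\mapsto\varphi(\alpha)$). One has $j\circ u=\varphi\circ j$, so $u^*j^*M=j^*\varphi^*M$. *)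

(* Defs.v *)
From HB Require Import structures.
From mathcomp Require Import all_boot all_order all_algebra.
From mathcomp Require Import boolp zify.

Set Implicit Arguments.
Unset Strict Implicit.
Unset Printing Implicit Defensive.

Import Order.TTheory GRing.Theory.
Local Open Scope ring_scope.
Local Open Scope quotient_scope.

(* Small categories: objects and morphisms form types, and equality of objects,
   morphisms and functors is Leibniz equality (which is extensional thanks to
   the axioms of boolp). *)

Record category := Category {
  obj :> Type;
  mor : obj -> obj -> Type;
  idm : forall a, mor a a;
  catcomp : forall a b c, mor b c -> mor a b -> mor a c;
  comp_idl : forall a b (f : mor a b), catcomp (idm b) f = f;
  comp_idr : forall a b (f : mor a b), catcomp f (idm a) = f;
  compA : forall a b c d (h : mor c d) (g : mor b c) (f : mor a b),
    catcomp h (catcomp g f) = catcomp (catcomp h g) f }.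

Arguments mor {A} a b : rename.
Arguments idm {A} a : rename.
Arguments catcomp {A a b c} g f : rename.

Record functor (A B : category) := Functor {
  fobj :> A -> B;
  fmap : forall a b, mor a b -> mor (fobj a) (fobj b);
  fmap_id : forall a, fmap (idm a) = idm (fobj a);
  fmap_comp : forall a b c (g : mor b c) (f : mor a b),
    fmap (catcomp g f) = catcomp (fmap g) (fmap f) }.

Arguments fmap {A B} F {a b} f : rename.

Lemma functor_congr (A B : category) (fo : A -> B)
    (fm fm' : forall a b, mor a b -> mor (fo a) (fo b)) p q p' q' :
  (forall a b (f : mor a b), fm a b f = fm' a b f) ->
  @Functor A B fo fm p q = @Functor A B fo fm' p' q'.
Proof.
move=> e; have {}e : fm = fm'.
  by do 3 (apply: functional_extensionality_dep => ?).
by subst fm'; congr Functor; apply: Prop_irrelevance.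
Qed.

Program Definition functor_id (A : category) : functor A A :=
  @Functor A A (fun a => a) (fun a b f => f) _ _.

Program Definition functor_comp (A B C : category)
    (G : functor B C) (F : functor A B) : functor A C :=
  @Functor A C (fun a => G (F a)) (fun a b f => fmap G (fmap F f)) _ _.
Next Obligation. by rewrite !fmap_id. Qed.
Next Obligation. by rewrite !fmap_comp. Qed.

(* Functors A -> R-Mod.  They are kept apart from functor because R-Mod is not
   small: seeing it as a category would conflict with the universe constraint
   that products of R-modules over the simplices of a nerve are R-modules. *)

Record rmod_functor (R : pzRingType) (A : category) := RmodFunctor {
  mobj :> A -> lmodType R;
  mmap : forall a b, mor a b -> {linear mobj a -> mobj b};
  mmap_id : forall a (x : mobj a), mmap (idm a) x = x;
  mmap_comp : forall a b c (g : mor b c) (f : mor a b) (x : mobj a),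
    mmap (catcomp g f) x = mmap g (mmap f x) }.

Arguments mmap {R A} M {a b} f : rename.

Record rmod_nat (R : pzRingType) (A : category) (M N : rmod_functor R A) :=
  RmodNat {
  ncomp :> forall a, {linear M a -> N a};
  ncomp_natural : forall a b (f : mor a b) (x : M a),
    ncomp b (mmap M f x) = mmap N f (ncomp a x) }.

Program Definition rmod_functor_comp (R : pzRingType) (A B : category)
    (M : rmod_functor R B) (F : functor A B) : rmod_functor R A :=
  @RmodFunctor R A (fun a => M (F a)) (fun a b f => mmap M (fmap F f)) _ _.
Next Obligation. by rewrite fmap_id mmap_id. Qed.
Next Obligation. by rewrite fmap_comp mmap_comp. Qed.

Record cochain_complex (R : pzRingType) := CochainComplex {
  cochain :> nat -> lmodType R;
  differential : forall n, {linear cochain n -> cochain n.+1};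
  differential_sq : forall n (x : cochain n), differential n.+1 (differential n x) = 0 }.

Arguments differential {R K n} : rename.

Record cochain_map (R : pzRingType) (K L : cochain_complex R) := CochainMap {
  cmap :> forall n, {linear K n -> L n};
  cmap_diff : forall n (x : K n),
    cmap n.+1 (differential x) = differential (cmap n x) }.

Section QuotientModule.
Variables (R : pzRingType) (V : lmodType R) (B : zmodClosed V).
Hypothesis B_scale : GRing.scaler_closed B.

(* The library's quotient of a zmodType, here given its R-module structure. *)
Definition quot_mod of GRing.scaler_closed B : Type := Quotient.quot B.
Local Notation Q := (quot_mod B_scale).

HB.instance Definition _ := Choice.on Q.
HB.instance Definition _ := EqQuotient.on Q.
HB.instance Definition _ := GRing.Zmodule.on Q.

Definition quot_scale (a : R) (x : Q) : Q :=
  \pi_Q (a *: repr x).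

Lemma quot_mod_eqP (x y : V) :
  reflect (\pi_Q x = \pi_Q y) (x - y \in B).
Proof.
by rewrite Quotient.idealrBE; exact: eqP.
Qed.

Lemma pi_quot_modD x y : \pi_Q (x + y) = \pi_Q x + \pi_Q y.
Proof. exact: (@Quotient.pi_add V B). Qed.

Lemma pi_quot_modZ a x : \pi_Q (a *: x) = quot_scale a (\pi_Q x).
Proof.
rewrite /quot_scale; apply/quot_mod_eqP; rewrite -scalerBr; apply: B_scale.
by apply/quot_mod_eqP; rewrite reprK.
Qed.

Fact quot_scaleA a b v : quot_scale a (quot_scale b v) = quot_scale (a * b) v.
Proof. by rewrite -[v]reprK -!pi_quot_modZ reprK scalerA. Qed.
Fact quot_scale1 : left_id 1 quot_scale.
Proof. by move=> v; rewrite -[v]reprK -!pi_quot_modZ scale1r. Qed.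
Fact quot_scaleDr : right_distributive quot_scale +%R.
Proof.
move=> a u v; rewrite -[u]reprK -[v]reprK.
by rewrite -pi_quot_modD -!pi_quot_modZ -pi_quot_modD scalerDr.
Qed.
Fact quot_scaleDl v : {morph quot_scale^~ v : a b / a + b}.
Proof.
move=> a b; rewrite -[v]reprK.
by rewrite -!pi_quot_modZ -pi_quot_modD scalerDl.
Qed.

HB.instance Definition _ := GRing.Zmodule_isLmodule.Build R Q
  quot_scaleA quot_scale1 quot_scaleDr quot_scaleDl.

Fact pi_quot_mod_linear : linear \pi_Q.
Proof. by move=> a x y; rewrite pi_quot_modD pi_quot_modZ. Qed.
HB.instance Definition _ :=
  GRing.isLinear.Build R V Q _ \pi_Q pi_quot_mod_linear.

End QuotientModule.

Section Cohomology.
Variables (R : pzRingType) (K : cochain_complex R) (n : nat).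

Definition is_cocycle : {pred K n} := fun z => differential z == 0.

Fact is_cocycle_submod : submod_closed is_cocycle.
Proof.
split=> [|a x y]; rewrite !unfold_in ?linear0 //.
by move=> /eqP x0 /eqP y0; rewrite linearP x0 y0 scaler0 addr0.
Qed.
HB.instance Definition _ :=
  GRing.isSubmodClosed.Build R (K n) is_cocycle is_cocycle_submod.

Record cocycle : Type :=
  Cocycle { cocycle_val :> K n; cocycleP : cocycle_val \in is_cocycle }.

HB.instance Definition _ := [isSub for cocycle_val].
HB.instance Definition _ := [Choice of cocycle by <:].
HB.instance Definition _ :=
  GRing.SubChoice_isSubLmodule.Build R (K n) is_cocycle cocycle
    is_cocycle_submod.

(* The image of the differential; for n = 0 the incoming differential is 0. *)
Definition coboundary : K n -> Prop :=
  match n return K n -> Prop with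
  | 0 => fun z => z = 0
  | m.+1 => fun z => exists y : K m, z = differential y
  end.

Definition is_coboundary : {pred cocycle} := fun z => `[< coboundary (val z) >].

Fact coboundary_linear a x y :
  coboundary x -> coboundary y -> coboundary (a *: x + y).
Proof.
rewrite /coboundary; case: (n) x y => [|m] x y.
  by move=> -> ->; rewrite scaler0 addr0.
by move=> [x' ->] [y' ->]; exists (a *: x' + y'); rewrite linearP.
Qed.

Fact is_coboundary_submod : submod_closed is_coboundary.
Proof.
split=> [|a x y /asboolP x0 /asboolP y0]; apply/asboolP; last first.
  by rewrite linearP; exact: coboundary_linear.
rewrite linear0 /coboundary; case: (n) => [|m] //.
by exists 0; rewrite linear0.
Qed.
HB.instance Definition _ :=
  GRing.isZmodClosed.Build cocycle is_coboundary
    (GRing.submod_closedB is_coboundary_submod).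

Fact is_coboundary_scale : GRing.scaler_closed is_coboundary.
Proof. exact: GRing.subsemimod_closedZ is_coboundary_submod. Qed.

Definition cohomology : lmodType R := quot_mod is_coboundary_scale.

Definition cohomology_class (z : cocycle) : cohomology :=
  \pi_cohomology z.

End Cohomology.

Arguments is_cocycle {R} K n _.
Arguments is_coboundary {R} K n _.

Section CohomologyMap.
Variables (R : pzRingType) (K L : cochain_complex R) (F : cochain_map K L).
Variable n : nat.

Fact cocycle_map_subproof (z : cocycle K n) : F n (val z) \in is_cocycle L n.
Proof.
by rewrite unfold_in -cmap_diff (eqP (cocycleP z)) linear0.
Qed.

Definition cocycle_map (z : cocycle K n) : cocycle L n :=
  Cocycle (cocycle_map_subproof z).

Definition cohomology_map (x : cohomology K n) : cohomology L n :=
  cohomology_class (cocycle_map (repr x)).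

Fact cocycle_map_linear : linear cocycle_map.
Proof. by move=> a x y; apply: val_inj; rewrite !linearP /= linearP. Qed.

Fact coboundary_map (z : K n) : coboundary z -> coboundary (F n z).
Proof.
rewrite /coboundary; case: (n) z => [|m] z; first by move=> ->; rewrite linear0.
by move=> [y ->]; exists (F m y); rewrite cmap_diff.
Qed.

Lemma cohomology_mapE (z : cocycle K n) :
  cohomology_map (cohomology_class z) = cohomology_class (cocycle_map z).
Proof.
apply/(quot_mod_eqP (@is_coboundary_scale _ _ _)); apply/asboolP => /=.
have: repr (cohomology_class z) - z \in is_coboundary K n.
  by apply/(quot_mod_eqP (@is_coboundary_scale _ _ _)); exact: reprK.
move=> /asboolP /coboundary_map; congr coboundary.
by rewrite -!raddfB.
Qed.

Fact cohomology_map_linear : linear cohomology_map.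
Proof.
move=> a x y; rewrite -[x]reprK -[y]reprK.
have cE u : \pi_(cohomology K n) u = cohomology_class u by [].
have lin (N : cochain_complex R) (b : R) (u v : cocycle N n) :
    cohomology_class (b *: u + v)
    = b *: cohomology_class u + cohomology_class v.
  exact: pi_quot_mod_linear.
by rewrite !cE -lin !cohomology_mapE -lin cocycle_map_linear.
Qed.
HB.instance Definition _ :=
  GRing.isLinear.Build R (cohomology K n) (cohomology L n) _ cohomology_map
    cohomology_map_linear.

End CohomologyMap.

Lemma omorph_ext d (T : porderType d) d' (T' : porderType d')
  (f g : {omorphism T -> T'}) : f =1 g -> f = g.
Proof.
case: f g => [f [[pf]]] [g [[pg]]] /= /funext e.
by subst g; rewrite (Prop_irrelevance pf pg).
Qed.

(* The object [n] = {0 < ... < n} is encoded by the natural number n. *)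
Program Definition simplex_category : category :=
  @Category nat (fun m n => {omorphism 'I_m.+1 -> 'I_n.+1}) (fun n => idfun)
    (fun m n p g f => (g \o f : {omorphism _ -> _})) _ _ _.
Next Obligation. by apply: omorph_ext. Qed.
Next Obligation. by apply: omorph_ext. Qed.
Next Obligation. by apply: omorph_ext. Qed.

Definition coface_fun n (i : 'I_n.+2) : 'I_n.+1 -> 'I_n.+2 := lift i.

Fact coface_fun_le n (i : 'I_n.+2) :
  {homo @coface_fun n i : x y / (x <= y)%O >-> (x <= y)%O}.
Proof. by move=> x y; rewrite !leEord /= leq_bump2. Qed.
HB.instance Definition _ n (i : 'I_n.+2) :=
  Order.isOrderMorphism.Build _ _ _ _ (@coface_fun n i) (@coface_fun_le n i).

Definition coface n (i : 'I_n.+2) : @mor simplex_category n n.+1 :=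
  (@coface_fun n i : {omorphism _ -> _}).

Section CochainComplexOfCosimplicial.
Variables (R : pzRingType).
Implicit Type A : rmod_functor R simplex_category.

Definition alternating_sum A (n : nat) (z : A n) : A n.+1 :=
  \sum_(i < n.+2) (-1) ^+ i *: mmap A (coface i) z.

Fact alternating_sum_linear A (n : nat) : linear (@alternating_sum A n).
Proof.
move=> a x y; rewrite /alternating_sum scaler_sumr -big_split /=.
apply: eq_bigr => i _; rewrite linearP scalerDr !scalerA.
by rewrite (commr_sign a i).
Qed.
HB.instance Definition _ A (n : nat) :=
  GRing.isLinear.Build R (A n) (A n.+1) _ (@alternating_sum A n)
    (@alternating_sum_linear A n).

Fact coface_comp n (i : 'I_n.+2) (j : 'I_n.+2) (i' j' : 'I_n.+3) :
  (i <= j)%N -> i' = i :> nat -> j' = j.+1 :> nat ->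
  catcomp (coface j') (coface i) = catcomp (coface i') (coface j).
Proof.
move=> ij ei ej; apply: omorph_ext => k; apply: val_inj => /=.
by rewrite ei ej /bump; lia.
Qed.

Fact alternating_sum_sq A (n : nat) (z : A n) :
  alternating_sum (alternating_sum z) = 0.
Proof.
rewrite /alternating_sum.
under eq_bigr => j _ do rewrite linear_sum scaler_sumr.
rewrite pair_big.
under eq_bigr => p _ do rewrite linearZ scalerA -exprD -mmap_comp.
rewrite (bigID (fun p : 'I_n.+3 * 'I_n.+2 => (p.2 < p.1)%N)).
apply/eqP; rewrite addr_eq0 -sumrN; apply/eqP.
pose h (p : 'I_n.+3 * 'I_n.+2) : 'I_n.+3 * 'I_n.+2 :=
  (lift ord0 p.2, inord p.1).
pose h' (p : 'I_n.+3 * 'I_n.+2) : 'I_n.+3 * 'I_n.+2 :=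
  (inord p.2, inord p.1.-1).
rewrite (reindex_onto h h'); last first.
  move=> [[j jn] [i ni]] /= ij; congr pair; apply: val_inj; rewrite /= /bump.
    by rewrite inordK; lia.
  by rewrite !inordK; lia.
apply: eq_big => [[[j jn] [i ni]]|[[j jn] [i ni]]] /=.
  rewrite /h' /h xpair_eqE -!val_eqE /= /bump.
  case: (leqP n.+2 j) => [nj|jn']; last by rewrite !inordK //; lia.
  have := ltn_ord (inord j : 'I_n.+2); move: (inord _ : 'I_n.+2) => k kn.
  by rewrite inordK; lia.
move=> /andP[+ /eqP[/(congr1 val) + _]]; rewrite /= /bump => + ej.
have jn' : (j < n.+2)%N.
  have := ltn_ord (inord j : 'I_n.+2); move: (inord j : 'I_n.+2) ej => k.
  by move=> + kn; rewrite inordK; lia.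
rewrite inordK // => ij.
have := @coface_comp n (inord j) (Ordinal ni) (Ordinal jn)
  (lift ord0 (Ordinal ni)).
rewrite /= inordK // => /(_ ij erefl erefl).
move=> /(congr1 (fun f => @mmap R _ A n n.+2 f z)) /= ->.
by rewrite -scaleNr add1n addSn exprS mulN1r addnC.
Qed.

Definition cochain_of_cosimplicial A : cochain_complex R :=
  @CochainComplex R A (fun n => @alternating_sum A n) (@alternating_sum_sq A).

Program Definition cochain_map_of_cosimplicial A B (F : rmod_nat A B) :
    cochain_map (cochain_of_cosimplicial A) (cochain_of_cosimplicial B) :=
  @CochainMap R (cochain_of_cosimplicial A) (cochain_of_cosimplicial B)
    (fun n => F n) _.
Next Obligation.
rewrite /=; rewrite /alternating_sum linear_sum.
by apply: eq_bigr => i _; rewrite linearZ ncomp_natural.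
Qed.

End CochainComplexOfCosimplicial.

Section DependentProduct.
Variables (R : pzRingType) (I : Type) (V : I -> lmodType R).

Definition prod_mod : Type := forall i, V i.
Implicit Types x y z : prod_mod.

HB.instance Definition _ := gen_eqMixin prod_mod.
HB.instance Definition _ := gen_choiceMixin prod_mod.

Lemma prod_mod_ext x y : (forall i, x i = y i) -> x = y.
Proof. exact: functional_extensionality_dep. Qed.

Let add x y : prod_mod := fun i => x i + y i.
Let opp x : prod_mod := fun i => - x i.
Let scale (a : R) x : prod_mod := fun i => a *: x i.

Fact prod_mod_addA : associative add.
Proof. by move=> x y z; apply: prod_mod_ext => i; exact: addrA. Qed.
Fact prod_mod_addC : commutative add.
Proof. by move=> x y; apply: prod_mod_ext => i; exact: addrC. Qed.
Fact prod_mod_add0 : left_id ((fun i => 0) : prod_mod) add.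
Proof. by move=> x; apply: prod_mod_ext => i; exact: add0r. Qed.
Fact prod_mod_addN : left_inverse ((fun i => 0) : prod_mod) opp add.
Proof. by move=> x; apply: prod_mod_ext => i; exact: addNr. Qed.

HB.instance Definition _ := GRing.isZmodule.Build prod_mod
  prod_mod_addA prod_mod_addC prod_mod_add0 prod_mod_addN.

Fact prod_mod_scaleA a b x : scale a (scale b x) = scale (a * b) x.
Proof. by apply: prod_mod_ext => i; exact: scalerA. Qed.
Fact prod_mod_scale1 : left_id 1 scale.
Proof. by move=> x; apply: prod_mod_ext => i; exact: scale1r. Qed.
Fact prod_mod_scaleDr : right_distributive scale +%R.
Proof. by move=> a x y; apply: prod_mod_ext => i; exact: scalerDr. Qed.
Fact prod_mod_scaleDl x : {morph scale^~ x : a b / a + b}.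
Proof. by move=> a b; apply: prod_mod_ext => i; exact: scalerDl. Qed.

HB.instance Definition _ := GRing.Zmodule_isLmodule.Build R prod_mod
  prod_mod_scaleA prod_mod_scale1 prod_mod_scaleDr prod_mod_scaleDl.

End DependentProduct.

(* pull f is the action f^* : X_n -> X_m of f : [m] -> [n]. *)
Record simplicial_set := SimplicialSet {
  simplex :> nat -> Type;
  pull : forall m n, @mor simplex_category m n -> simplex n -> simplex m;
  pull_id : forall n (s : simplex n), pull (@idm simplex_category n) s = s;
  pull_comp : forall m n p (g : @mor simplex_category n p)
    (f : @mor simplex_category m n) (s : simplex p),
    pull (catcomp g f) s = pull f (pull g s) }.

Arguments pull {X m n} f s : rename.

Record simplicial_map (X Y : simplicial_set) := SimplicialMap {
  smap :> forall n, X n -> Y n;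
  smap_pull : forall m n (f : @mor simplex_category m n) (s : X n),
    smap (pull f s) = pull f (smap s) }.

Section SimplexCategory.
Variable X : simplicial_set.

Definition simplices_obj : Type := {n : nat & X n}.
Definition simplices_mor (t s : simplices_obj) : Type :=
  {f : @mor simplex_category (projT1 t) (projT1 s) |
    pull f (projT2 s) = projT2 t}.

Lemma simplices_mor_ext (t s : simplices_obj) (f g : simplices_mor t s) :
  sval f = sval g -> f = g.
Proof. by case: f g => f p [g q]; exact: eq_exist. Qed.

Program Definition simplices : category :=
  @Category simplices_obj simplices_mor
    (fun s => exist _ (@idm simplex_category (projT1 s)) _)
    (fun r s t g f => exist _ (catcomp (sval g) (sval f)) _) _ _ _.
Next Obligation. by exact: pull_id. Qed.
Next Obligation. by rewrite pull_comp (svalP g) (svalP f). Qed.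
Next Obligation. by apply: simplices_mor_ext; exact: comp_idl. Qed.
Next Obligation. by apply: simplices_mor_ext; exact: comp_idr. Qed.
Next Obligation. by apply: simplices_mor_ext; exact: compA. Qed.

(* f, seen as a morphism ([m], pull f s) -> ([n], s) *)
Definition simplex_mor m n (f : @mor simplex_category m n) (s : X n) :
    @mor simplices (existT X m (pull f s)) (existT X n s) :=
  exist _ f erefl.

End SimplexCategory.

Program Definition simplices_functor (X Y : simplicial_set)
    (F : simplicial_map X Y) : functor (simplices X) (simplices Y) :=
  @Functor (simplices X) (simplices Y)
    (fun s => existT Y (projT1 s) (F _ (projT2 s)))
    (fun t s f => exist _ (sval f) _) _ _.
Next Obligation. by rewrite -smap_pull (svalP f). Qed.
Next Obligation. by apply: simplices_mor_ext. Qed.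
Next Obligation. by apply: simplices_mor_ext. Qed.

Definition coef_system (R : pzRingType) (X : simplicial_set) :=
  rmod_functor R (simplices X).

Definition coef_pullback (R : pzRingType) (X Y : simplicial_set)
    (F : simplicial_map X Y) (M : coef_system R Y) : coef_system R X :=
  rmod_functor_comp M (simplices_functor F).

Section GabrielZisman.
Variables (R : pzRingType) (X : simplicial_set) (M : coef_system R X).

Definition gz_cochain (n : nat) : lmodType R :=
  prod_mod (fun s : X n => M (existT X n s)).

Definition gz_act m n (f : @mor simplex_category m n) (z : gz_cochain m) :
    gz_cochain n :=
  fun s => mmap M (simplex_mor f s) (z (pull f s)).

Fact gz_act_linear m n (f : @mor simplex_category m n) : linear (gz_act f).
Proof.
by move=> a x y; apply: prod_mod_ext => s; rewrite /gz_act linearP.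
Qed.
HB.instance Definition _ m n (f : @mor simplex_category m n) :=
  GRing.isLinear.Build R (gz_cochain m) (gz_cochain n) _ (gz_act f)
    (gz_act_linear f).

Lemma gz_actE m n (t : X m) (s : X n)
    (f : @mor (simplices X) (existT X m t) (existT X n s)) (z : gz_cochain m) :
  gz_act (sval f) z s = mmap M f (z t).
Proof.
suff H (g : @mor simplex_category m n) (e : pull g s = t) :
    gz_act g z s = @mmap _ _ M (existT X m t) (existT X n s) (exist _ g e) (z t).
  by case: f => f e; exact: H.
by destruct e.
Qed.

Program Definition gz_cosimplicial : rmod_functor R simplex_category :=
  @RmodFunctor R simplex_category gz_cochain (fun m n f => gz_act f) _ _.
Next Obligation.
apply: prod_mod_ext => s.
by rewrite (gz_actE (idm (existT X a s : simplices X))) mmap_id.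
Qed.
Next Obligation.
apply: prod_mod_ext => s.
pose h := @catcomp (simplices X) _ _ _
  (simplex_mor g s) (simplex_mor f (pull g s)).
by rewrite (gz_actE h) mmap_comp.
Qed.

Definition gz_complex : cochain_complex R :=
  cochain_of_cosimplicial gz_cosimplicial.

Definition gz_cohomology (n : nat) : lmodType R := cohomology gz_complex n.

End GabrielZisman.

Section GabrielZiszmanMap.
Variables (R : pzRingType) (X Y : simplicial_set) (F : simplicial_map X Y).
Variable M : coef_system R Y.

Definition gz_pullback n (z : gz_cochain M n) :
    gz_cochain (coef_pullback F M) n :=
  fun s => z (F n s).

Fact gz_pullback_linear n : linear (@gz_pullback n).
Proof. by move=> a x y; apply: prod_mod_ext. Qed.
HB.instance Definition _ n :=
  GRing.isLinear.Build R (gz_cochain M n)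
    (gz_cochain (coef_pullback F M) n) _ (@gz_pullback n)
    (@gz_pullback_linear n).

Program Definition gz_pullback_nat :
    rmod_nat (gz_cosimplicial M) (gz_cosimplicial (coef_pullback F M)) :=
  @RmodNat R simplex_category (gz_cosimplicial M)
    (gz_cosimplicial (coef_pullback F M)) gz_pullback _.
Next Obligation.
apply: prod_mod_ext => s; rewrite /gz_pullback.
exact: (gz_actE (fmap (simplices_functor F) (simplex_mor f s))).
Qed.

Definition gz_map n : {linear gz_cohomology M n ->
                              gz_cohomology (coef_pullback F M) n} :=
  @cohomology_map R _ _ (cochain_map_of_cosimplicial gz_pullback_nat) n.

End GabrielZiszmanMap.

(* The canonical map between cohomologies with equal coefficient systems. *)
Definition gz_cast (R : pzRingType) (X : simplicial_set)
    (M M' : coef_system R X) (e : M = M') n :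
    {linear gz_cohomology M n -> gz_cohomology M' n} :=
  match e in _ = N return {linear gz_cohomology M n -> gz_cohomology N n} with
  | erefl => idfun
  end.

(* [n] as a poset category *)
Program Definition ordinal_category n : category :=
  @Category 'I_n.+1 (fun i j => (i <= j)%O) (fun i => lexx i)
    (fun i j k g f => le_trans f g) _ _ _.

Lemma ordinal_mor_irr n (i j : ordinal_category n) (f g : mor i j) : f = g.
Proof. exact: (@Prop_irrelevance (i <= j)%O). Qed.

Program Definition ordinal_functor m n (f : @mor simplex_category m n) :
    functor (ordinal_category m) (ordinal_category n) :=
  @Functor (ordinal_category m) (ordinal_category n)
    (f : {omorphism 'I_m.+1 -> 'I_n.+1})
    (fun i j ij => omorph_le f ij) _ _.

(* The n-simplices of the nerve are the functors [n] -> C, i.e. the chains of n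
   composable morphisms; the simplicial structure is precomposition. *)
Program Definition nerve (C : category) : simplicial_set :=
  @SimplicialSet (fun n => functor (ordinal_category n) C)
    (fun m n f s => functor_comp s (ordinal_functor f)) _ _.
Next Obligation.
case: s => fo fm p q; apply: functor_congr => i j ij /=.
by congr fm; exact: ordinal_mor_irr.
Qed.
Next Obligation.
apply: functor_congr => i j ij /=.
by congr (fmap s); exact: ordinal_mor_irr.
Qed.

Program Definition nerve_map (A B : category) (psi : functor A B) :
    simplicial_map (nerve A) (nerve B) :=
  @SimplicialMap (nerve A) (nerve B) (fun n s => functor_comp psi s) _.
Next Obligation. by apply: functor_congr. Qed.

Definition thomason (R : pzRingType) (C : category)
    (M : coef_system R (nerve C)) (n : nat) : lmodType R :=
  gz_cohomology M n.

Definition th_pullback (R : pzRingType) (A B : category) (psi : functor A B)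
    (M : coef_system R (nerve B)) : coef_system R (nerve A) :=
  coef_pullback (nerve_map psi) M.

Definition thomason_map (R : pzRingType) (A B : category) (psi : functor A B)
    (M : coef_system R (nerve B)) (n : nat) :
    {linear thomason M n -> thomason (th_pullback psi M) n} :=
  gz_map (nerve_map psi) M n.

Lemma simplicial_map_ext (X Y : simplicial_set) (F G : simplicial_map X Y) :
  (forall n s, F n s = G n s) -> F = G.
Proof.
case: F G => F p [G q] /= e; have {}e : F = G.
  by do 2 (apply: functional_extensionality_dep => ?).
by subst G; congr SimplicialMap; apply: Prop_irrelevance.
Qed.

Program Definition simplicial_comp (X Y Z : simplicial_set)
    (G : simplicial_map Y Z) (F : simplicial_map X Y) : simplicial_map X Z :=
  @SimplicialMap X Z (fun n s => G n (F n s)) _.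
Next Obligation. by rewrite !smap_pull. Qed.

Lemma coef_pullback_comp (R : pzRingType) (X Y Z : simplicial_set)
    (G : simplicial_map Y Z) (F : simplicial_map X Y) (M : coef_system R Z) :
  coef_pullback F (coef_pullback G M) = coef_pullback (simplicial_comp G F) M.
Proof.
rewrite /coef_pullback; have <- :
    functor_comp (simplices_functor G) (simplices_functor F)
    = simplices_functor (simplicial_comp G F).
  by apply: functor_congr => t s f; apply: simplices_mor_ext.
by congr RmodFunctor; exact: Prop_irrelevance.
Qed.

Lemma nerve_map_comp (A B C : category) (psi : functor B C)
    (chi : functor A B) :
  simplicial_comp (nerve_map psi) (nerve_map chi)
  = nerve_map (functor_comp psi chi).
Proof. by apply: simplicial_map_ext => n s; exact: functor_congr. Qed.

Lemma th_pullback_comp (R : pzRingType) (A B C : category)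
    (psi : functor B C) (chi : functor A B) (M : coef_system R (nerve C)) :
  th_pullback chi (th_pullback psi M) = th_pullback (functor_comp psi chi) M.
Proof. by rewrite /th_pullback coef_pullback_comp nerve_map_comp. Qed.

Section Comma.
Variables (C D : category) (phi : functor C D) (d : D).

Definition comma_obj : Type := {c : C & mor (phi c) d}.
Definition comma_mor (x y : comma_obj) : Type :=
  {a : mor (projT1 x) (projT1 y) |
    catcomp (projT2 y) (fmap phi a) = projT2 x}.

Lemma comma_mor_ext (x y : comma_obj) (f g : comma_mor x y) :
  sval f = sval g -> f = g.
Proof. by case: f g => f p [g q]; exact: eq_exist. Qed.

Program Definition comma : category :=
  @Category comma_obj comma_mor
    (fun x => exist _ (idm (projT1 x)) _)
    (fun x y z g f => exist _ (catcomp (sval g) (sval f)) _) _ _ _.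
Next Obligation. by rewrite fmap_id comp_idr. Qed.
Next Obligation. by rewrite fmap_comp compA (svalP g) (svalP f). Qed.
Next Obligation. by apply: comma_mor_ext; exact: comp_idl. Qed.
Next Obligation. by apply: comma_mor_ext; exact: comp_idr. Qed.
Next Obligation. by apply: comma_mor_ext; exact: compA. Qed.

Program Definition comma_j : functor comma C :=
  @Functor comma C (fun x => projT1 x) (fun x y f => sval f) _ _.

End Comma.

Program Definition comma_u (C D : category) (phi : functor C D) (d : D) :
    functor (comma phi d) (comma (functor_id D) d) :=
  @Functor (comma phi d) (comma (functor_id D) d)
    (fun x => existT _ (phi (projT1 x)) (projT2 x))
    (fun x y f => exist _ (fmap phi (sval f)) _) _ _.
Next Obligation. by exact: (svalP f). Qed.
Next Obligation. by apply: comma_mor_ext; exact: fmap_id. Qed.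
Next Obligation. by apply: comma_mor_ext; exact: fmap_comp. Qed.

Lemma comma_j_u (C D : category) (phi : functor C D) (d : D) :
  functor_comp (comma_j (functor_id D) d) (comma_u phi d)
  = functor_comp phi (comma_j phi d).
Proof. exact: functor_congr. Qed.

Lemma comma_pullback (R : pzRingType) (C D : category) (phi : functor C D)
    (d : D) (M : coef_system R (nerve D)) :
  th_pullback (comma_u phi d) (th_pullback (comma_j (functor_id D) d) M)
  = th_pullback (comma_j phi d) (th_pullback phi M).
Proof. by rewrite !th_pullback_comp comma_j_u. Qed.

(* u^* : H(id/d; j^* M) -> H(phi/d; j^* phi^* M), where the coefficient systems
   u^* j^* M and j^* phi^* M are equal by comma_pullback, but not convertible. *)
Definition comma_map (R : pzRingType) (C D : category) (phi : functor C D)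
    (M : coef_system R (nerve D)) (d : D) (n : nat) :
    {linear thomason (th_pullback (comma_j (functor_id D) d) M) n ->
            thomason (th_pullback (comma_j phi d) (th_pullback phi M)) n} :=
  gz_cast (comma_pullback phi d M) n \o
    thomason_map (comma_u phi d) (th_pullback (comma_j (functor_id D) d) M) n.

(* Main.v *)
(* Consider the double complex with entries
     K^{p,q} = \prod_{d_0 -> ... -> d_p} C^q(phi/d_0; j^* phi^* M).
   An n-simplex of N(phi/d) is an n-simplex c_0 -> ... -> c_n of N C together
   with a morphism phi c_n -> d, so that, for fixed q, d |-> C^q(phi/d) is a
   product of functions on sets D(phi c, d): the row K^{*,q} is a coinduced
   resolution of C^q(C; phi^* M), contracted by
     (h x)(d_0 -> ... -> d_p; c, mu) = x(phi c -mu-> d_0 -> ... -> d_p; c, id).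
   The same holds for id_D in place of phi, and u^* is a map between the two
   double complexes, which is a quasi-isomorphism on each column by hypothesis.
   Hence so is the map C^*(D; M) -> C^*(C; phi^* M) of the resolved complexes:
   on mapping cones, this says that a complex with a resolution by acyclic
   complexes is acyclic. *)

From HB Require Import structures.
From mathcomp Require Import all_boot all_order all_algebra.
From mathcomp Require Import boolp.
Require Import Defs.

Set Implicit Arguments.
Unset Strict Implicit.
Unset Printing Implicit Defensive.

Import GRing.Theory.
Local Open Scope ring_scope.

Lemma dependent_choice_fun (I : Type) (V : I -> Type)
    (P : forall i, V i -> Prop) :
  (forall i, exists v, P i v) -> exists f : forall i, V i, forall i, P i (f i).
Proof.
by move=> e; exists (fun i => sval (cid (e i))) => i; exact: svalP (cid (e i)).
Qed.

(** * Cones and resolutions of cochain complexes *)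

Section Complexes.
Variable R : pzRingType.
Implicit Types K L : cochain_complex R.

Definition zero_mod : lmodType R := prod_mod (fun _ : void => R^o).

Lemma zero_mod_eq (x y : zero_mod) : x = y.
Proof. by apply: prod_mod_ext => -[]. Qed.

(* K n.-1, with 0 in degree -1: the coboundaries of degree 0 then need no
   special case. *)
Definition lower K n : lmodType R := if n is m.+1 then K m else zero_mod.

Definition lower_diff K n : {linear lower K n -> K n} :=
  match n return {linear lower K n -> K n} with
  | 0 => \0
  | m.+1 => @differential R K m
  end.

Lemma coboundaryP K n (z : K n) :
  coboundary z <-> exists y : lower K n, z = lower_diff K n y.
Proof.
case: n z => [|n] z //=; split=> [->|[y ->]] //; by exists 0.
Qed.

Lemma differential_lower K n (y : lower K n) :
  differential (lower_diff K n y) = 0.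
Proof. by case: n y => [|n] y /=; rewrite ?linear0 ?differential_sq. Qed.

Definition lower_map K L (F : cochain_map K L) n :
    {linear lower K n -> lower L n} :=
  match n return {linear lower K n -> lower L n} with
  | 0 => idfun
  | m.+1 => F m
  end.

Lemma lower_map_diff K L (F : cochain_map K L) n (y : lower K n) :
  F n (lower_diff K n y) = lower_diff L n (lower_map F n y).
Proof. by case: n y => [|n] y /=; rewrite ?linear0 ?cmap_diff. Qed.

Definition acyclic K : Prop :=
  forall n (z : K n), differential z = 0 -> coboundary z.

(** Phrased on cocycles, so that the diagram chases below never meet a quotient; [quasi_isoP] links
    it to cohomology. *)
Definition quasi_iso K L (F : cochain_map K L) : Prop :=
  forall n,
    (forall z : K n,
      differential z = 0 -> coboundary (F n z) -> coboundary z) /\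
    (forall w : L n, differential w = 0 ->
      exists2 z : K n, differential z = 0 & coboundary (w - F n z)).

Lemma cohomology_class_eq K n (z w : cocycle K n) :
  cohomology_class z = cohomology_class w <-> coboundary (val z - val w).
Proof.
split=> [/(quot_mod_eqP (@is_coboundary_scale _ _ _)) /asboolP|zw].
  by rewrite linearB.
by apply/(quot_mod_eqP (@is_coboundary_scale _ _ _))/asboolP; rewrite linearB.
Qed.

Lemma cohomology_classP K n (x : cohomology K n) :
  exists z, x = cohomology_class z.
Proof.
by exists (generic_quotient.repr x); rewrite [RHS]generic_quotient.reprK.
Qed.

Lemma cocycle_eq0 K n (z : cocycle K n) : differential (val z) = 0.
Proof. exact/eqP/cocycleP. Qed.

Lemma eq0_cocycle K n (z : K n) : differential z = 0 -> z \in is_cocycle K n.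
Proof. by move=> /eqP. Qed.

Lemma inj_surj_bijective (A B : Type) (f : A -> B) :
  injective f -> (forall b, exists a, b = f a) -> bijective f.
Proof.
move=> finj /choice[g gK]; exists g => [a|b]; last by rewrite -gK.
by apply: finj; rewrite -gK.
Qed.

Lemma quasi_isoP K L (F : cochain_map K L) :
  quasi_iso F <-> forall n, bijective (cohomology_map F (n := n)).
Proof.
split=> [qF n|bF n].
  have [Finj Fsurj] := qF n; apply: inj_surj_bijective.
    move=> x y; have [z ->] := cohomology_classP x.
    have [w ->] := cohomology_classP y; rewrite !cohomology_mapE.
    move=> /cohomology_class_eq /= zw; apply/cohomology_class_eq.
    apply: Finj; first by rewrite linearB !cocycle_eq0 subrr.
    by rewrite linearB.
  move=> y; have [w ->] := cohomology_classP y.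
  have [z z0 zw] := Fsurj (val w) (cocycle_eq0 w).
  exists (cohomology_class (Cocycle (eq0_cocycle z0))).
  by rewrite cohomology_mapE; apply/cohomology_class_eq.
split=> [z z0 Fz|w w0].
  have := bij_inj (bF n).
  move=> /(_ (cohomology_class (Cocycle (eq0_cocycle z0))) (cohomology_class 0)).
  rewrite !cohomology_mapE => inj.
  have /inj/cohomology_class_eq /= : 
    cohomology_class (cocycle_map F (Cocycle (eq0_cocycle z0))) =
    cohomology_class (cocycle_map F 0).
    by apply/cohomology_class_eq; rewrite /= [F n 0]linear0 subr0.
  by rewrite subr0.
have [g _ gK] := bF n.
pose c := cohomology_class (Cocycle (eq0_cocycle w0)).
have [z gc] := cohomology_classP (g c).
have := gK c; rewrite gc cohomology_mapE.
move=> /esym/cohomology_class_eq /= zw.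
by exists (val z) => //; exact: cocycle_eq0.
Qed.

End Complexes.

Section Cone.
Variables (R : pzRingType) (K L : cochain_complex R) (F : cochain_map K L).

(** The mapping cone, shifted so as to start in degree 0, where it is $K^0 \times 0$. *)
Definition cone_mod n : lmodType R := (K n * lower L n)%type.

Definition cone_diff n (x : cone_mod n) : cone_mod n.+1 :=
  (differential x.1, F n x.1 - lower_diff L n x.2).

Fact cone_diff_linear n : linear (@cone_diff n).
Proof.
move=> a x y; rewrite /cone_diff !linearP /=; congr pair.
rewrite -[RHS]/(a *: (F n x.1 - lower_diff L n x.2)
                + (F n y.1 - lower_diff L n y.2)).
by rewrite scalerBr scalerN addrACA.
Qed.
HB.instance Definition _ n :=
  GRing.isLinear.Build R (cone_mod n) (cone_mod n.+1) _ (@cone_diff n)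
    (@cone_diff_linear n).

Fact cone_diff_sq n (x : cone_mod n) : cone_diff (cone_diff x) = 0.
Proof.
rewrite /cone_diff /= differential_sq linearB /= differential_lower subr0.
by rewrite cmap_diff subrr.
Qed.

Definition cone : cochain_complex R :=
  @CochainComplex R cone_mod (fun n => @cone_diff n) cone_diff_sq.

(** A cocycle $(l,k)$ of the cone is a cocycle $l$ with a primitive $k$ of $F(l)$. Injectivity on
    $H^n$ comes from degree $n$ of the cone, surjectivity from degree $n+1$. *)
Lemma cone_acyclic : acyclic cone <-> quasi_iso F.
Proof.
split=> [cA n|qF n [l k]].
  split=> [z z0 /coboundaryP[k Fz]|w w0].
    have := @cA n (z, k); rewrite /= /cone_diff /= z0 Fz subrr => /(_ erefl).
    by case: (n) z k {z0 Fz} => [|m] z k [] // [y1 y2] [-> _]; exists y1.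
  have := @cA n.+1 (0, w).
  rewrite /= /cone_diff /= !linear0 w0 subrr => /(_ erefl)[[z k] /= [z0 ->]].
  by exists z => //; apply/coboundaryP; exists (- k); rewrite linearN addrC addKr.
rewrite /= /cone_diff /= => -[l0 /eqP]; rewrite subr_eq0 => /eqP Fl.
have [Finj _] := qF n.
have /(Finj _ l0) : coboundary (F n l) by apply/coboundaryP; exists k.
case: n l k l0 Fl {Finj} => [|n] l k l0 Fl /=.
  by move=> ->; congr pair; exact: zero_mod_eq.
move=> [l1 ll1].
(* The primitive [l1] of [l] need not be sent to [k]. The defect is a cocycle, hence [F n l2] up to
   a coboundary, and [l1 - l2] repairs it. *)
have : differential (F n l1 - k) = 0.
  by rewrite linearB -cmap_diff -ll1 Fl subrr.
move=> /(proj2 (qF n))[l2 l20 /coboundaryP[k' kk']].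
exists (l1 - l2, k'); rewrite /cone_diff /= linearB l20 subr0 -ll1 -kk'.
by rewrite linearB [X in _ - X]addrAC subKr.
Qed.

End Cone.

(** A double complex with commuting differentials whose augmented rows are exact in each degree [n].
    No total complex is formed. *)
Record resolution (R : pzRingType) (X : cochain_complex R) := Resolution {
  term :> nat -> cochain_complex R;
  aug : cochain_map X (term 0);
  step : forall p, cochain_map (term p) (term p.+1);
  aug_inj : forall n x, aug n x = 0 -> x = 0;
  step_aug : forall n x, step 0 n (aug n x) = 0;
  step_step : forall p n x, step p.+1 n (step p n x) = 0;
  aug_exact : forall n y, step 0 n y = 0 -> exists x, y = aug n x;
  step_exact : forall p n y, step p.+1 n y = 0 -> exists x, y = step p n x }.

Section Resolution.
Variables (R : pzRingType) (X : cochain_complex R) (A : resolution X).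
Hypothesis A_acyclic : forall p, acyclic (A p).

Lemma lower_step_exact p n (y : lower (A p.+1) n) :
  lower_map (step A p.+1) n y = 0 -> exists x, y = lower_map (step A p) n x.
Proof.
by case: n y => [|n] y; [exists 0; exact: zero_mod_eq | exact: step_exact].
Qed.

Lemma lower_step_step p n (y : lower (A p) n) :
  lower_map (step A p.+1) n (lower_map (step A p) n y) = 0.
Proof. by case: n y => [|n] y; [exact: zero_mod_eq | exact: step_step]. Qed.

(* The kernels of step form acyclic complexes: dimension shifting trades one
   degree n for one step p. *)
Lemma step_kernel_acyclic n p (x : A p n) :
  differential x = 0 -> step A p n x = 0 ->
  exists2 y : lower (A p) n,
    x = lower_diff (A p) n y & lower_map (step A p) n y = 0.
Proof.
elim: n p x => [|n IH] p x dx hx.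
  by exists 0; [exact: A_acyclic dx | rewrite linear0].
have /coboundaryP[y xy] := A_acyclic dx.
(* A primitive [y] of [x] may fail to lie in the kernel of [step]. Its image is a cocycle in that
   kernel one column further, so it has a primitive [v] killed by [step]; lifting [v] to [u] gives
   the correction. *)
have [||v hy hv] := IH p.+1 (step A p n y).
- by rewrite -cmap_diff -[differential y]xy.
- exact: step_step.
have [u vu] := lower_step_exact hv.
exists (y - lower_diff (A p) n u) => /=.
  by rewrite linearB differential_lower subr0.
by rewrite linearB hy vu -lower_map_diff subrr.
Qed.

(** By [aug_inj] and [aug_exact], [X] is the kernel of the first step, so this is the case $p=0$ of
    [step_kernel_acyclic]. *)
Lemma resolution_acyclic : acyclic X.
Proof.
move=> n x dx; have [||y xy hy] := @step_kernel_acyclic n 0 (aug A n x).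
- by rewrite -cmap_diff dx linear0.
- exact: step_aug.
case: n x dx y xy hy => [|n] x dx y xy hy.
  by apply: (@aug_inj _ _ A).
have [z yz] := aug_exact hy.
exists z; apply/eqP; rewrite -subr_eq0; apply/eqP; apply: (@aug_inj _ _ A).
by rewrite linearB xy yz /= cmap_diff subrr.
Qed.

End Resolution.

Section ConeMap.
Variables (R : pzRingType) (K L K' L' : cochain_complex R).
Variables (F : cochain_map K L) (F' : cochain_map K' L').
Variables (a : cochain_map K K') (b : cochain_map L L').
Hypothesis square : forall n x, b n (F n x) = F' n (a n x).

Definition cone_map_fun n (x : cone F n) : cone F' n :=
  (a n x.1, lower_map b n x.2).

Fact cone_map_linear n : linear (@cone_map_fun n).
Proof. by move=> c x y; rewrite /cone_map_fun !linearP. Qed.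
HB.instance Definition _ n :=
  GRing.isLinear.Build R (cone F n) (cone F' n) _ (@cone_map_fun n)
    (@cone_map_linear n).

Fact cone_map_diff n (x : cone F n) :
  cone_map_fun (differential x) = differential (cone_map_fun x).
Proof.
rewrite /cone_map_fun /= /cone_diff /= linearB square cmap_diff.
by rewrite lower_map_diff.
Qed.

Definition cone_map : cochain_map (cone F) (cone F') :=
  @CochainMap R (cone F) (cone F') (fun n => @cone_map_fun n) cone_map_diff.

End ConeMap.

Section ConeResolution.
Variables (R : pzRingType) (X Y : cochain_complex R) (F : cochain_map X Y).
Variables (A : resolution X) (B : resolution Y).
Variable G : forall p, cochain_map (A p) (B p).
Hypothesis G_aug : forall n x, aug B n (F n x) = G 0 n (aug A n x).
Hypothesis G_step : forall p n x,
  step B p n (G p n x) = G p.+1 n (step A p n x).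

Local Obligation Tactic := idtac.

(** Exactness is checked on each component. The second sits one degree lower, whence the separate
    case of degree 0, where it vanishes. *)
Program Definition cone_resolution : resolution (cone F) :=
  @Resolution R (cone F) (fun p => cone (G p)) (cone_map G_aug)
    (fun p => cone_map (@G_step p)) _ _ _ _ _.
Next Obligation.
case=> [|n] [x y] [/aug_inj ->].
  by move=> _; congr pair; exact: zero_mod_eq.
by move=> /aug_inj ->.
Qed.
Next Obligation.
case=> [|n] [x y]; rewrite /= /cone_map_fun /= step_aug.
  by congr pair; exact: zero_mod_eq.
by rewrite step_aug.
Qed.
Next Obligation.
by move=> p n x; rewrite /= /cone_map_fun /= step_step lower_step_step.
Qed.
Next Obligation.
case=> [|n] [y z] [/aug_exact[x ->]].
  by exists (x, 0); congr pair; exact: zero_mod_eq.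
by move=> /aug_exact[x' ->]; exists (x, x').
Qed.
Next Obligation.
move=> p n [y z] [/step_exact[x ->]].
by move=> /lower_step_exact[x' ->]; exists (x, x').
Qed.

Lemma quasi_iso_resolution :
  (forall p, quasi_iso (G p)) -> quasi_iso F.
Proof.
move=> qG; apply/cone_acyclic; apply: (@resolution_acyclic _ _ cone_resolution).
by move=> p; apply/cone_acyclic.
Qed.

End ConeResolution.

(** * Products of complexes *)

Section ProductComplex.
Variables (R : pzRingType) (I : Type).

Section Object.
Variable K : I -> cochain_complex R.

Definition prod_cochain n : lmodType R := prod_mod (fun i => K i n).

Definition prod_diff n (x : prod_cochain n) : prod_cochain n.+1 :=
  fun i => differential (x i).

Fact prod_diff_linear n : linear (@prod_diff n).
Proof. by move=> a x y; apply: prod_mod_ext => i; exact: linearP. Qed.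
HB.instance Definition _ n :=
  GRing.isLinear.Build R (prod_cochain n) (prod_cochain n.+1) _ (@prod_diff n)
    (@prod_diff_linear n).

Fact prod_diff_sq n (x : prod_cochain n) : prod_diff (prod_diff x) = 0.
Proof. by apply: prod_mod_ext => i; exact: differential_sq. Qed.

Definition prod_complex : cochain_complex R :=
  @CochainComplex R prod_cochain (fun n => @prod_diff n) prod_diff_sq.

Lemma prod_coboundary n (x : prod_complex n) :
  (forall i, coboundary (x i)) -> coboundary x.
Proof.
case: n x => [|n] x; first by move=> x0; apply: prod_mod_ext.
move=> /dependent_choice_fun[y xy]; exists (y : prod_complex n).
by apply: prod_mod_ext => i; exact: xy.
Qed.

Lemma coboundary_prod n (x : prod_complex n) i :
  coboundary x -> coboundary (x i).
Proof.
by case: n x => [|n] x; [move->|move=> [y ->]; exists (y i)].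
Qed.

End Object.

Section Map.
Variables (K L : I -> cochain_complex R) (F : forall i, cochain_map (K i) (L i)).

Definition prod_map_fun n (x : prod_complex K n) : prod_complex L n :=
  fun i => F i n (x i).

Fact prod_map_linear n : linear (@prod_map_fun n).
Proof. by move=> a x y; apply: prod_mod_ext => i; exact: linearP. Qed.
HB.instance Definition _ n :=
  GRing.isLinear.Build R (prod_complex K n) (prod_complex L n) _
    (@prod_map_fun n) (@prod_map_linear n).

Fact prod_map_diff n (x : prod_complex K n) :
  prod_map_fun (differential x) = differential (prod_map_fun x).
Proof. by apply: prod_mod_ext => i; exact: cmap_diff. Qed.

Definition prod_map : cochain_map (prod_complex K) (prod_complex L) :=
  @CochainMap R (prod_complex K) (prod_complex L) (fun n => @prod_map_fun n)
    prod_map_diff.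

Lemma prod_quasi_iso : (forall i, quasi_iso (F i)) -> quasi_iso prod_map.
Proof.
move=> qF n; split=> [z z0 Fz|w w0].
  apply: prod_coboundary => i; apply: (proj1 (qF i n)).
    exact: (congr1 (fun f => f i) z0).
  exact: (coboundary_prod i Fz).
have /dependent_choice_fun[z zP] : forall i, exists z : K i n,
    differential z = 0 /\ coboundary (w i - F i n z).
  move=> i; have [|z] := proj2 (qF i n) (w i); last by exists z.
  exact: (congr1 (fun f => f i) w0).
exists (z : prod_complex K n).
  by apply: prod_mod_ext => i; exact: (proj1 (zP i)).
by apply: prod_coboundary => i; exact: (proj2 (zP i)).
Qed.

End Map.
End ProductComplex.

(** * Cochains of a category with coefficients in a presheaf of complexes *)

Section Chains.
Variable D : category.

(* [chain p d] is the type of p-simplices d -> e_1 -> ... -> e_p of the nerve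
   starting at d. *)
Fixpoint chain p (d : D) : Type :=
  if p is q.+1 then {e : D & (mor d e * chain q e)%type} else unit.

Definition chain_cons p (d e : D) (f : mor d e) (t : chain p e) :
  chain p.+1 d := existT _ e (f, t).

Lemma chainSP p (d : D) (P : chain p.+1 d -> Prop) :
  (forall e f t, P (@chain_cons p d e f t)) -> forall t, P t.
Proof. by move=> H [e [f t]]; exact: H. Qed.

(* Replaces the first vertex: d -> e -> e_1 -> ... becomes d -> e_1 -> ... *)
Definition chain_precomp p (d e : D) (f : mor d e) :
    chain p e -> chain p d :=
  match p return chain p e -> chain p d with
  | 0 => fun=> tt
  | q.+1 => fun t => @chain_cons q d _ (catcomp (projT2 t).1 f) (projT2 t).2
  end.

Lemma chain_precomp_comp p (a b c : D) (f : mor a b)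
    (g : mor b c) (t : chain p c) :
  chain_precomp f (chain_precomp g t) = chain_precomp (catcomp g f) t.
Proof. by case: p t => [|p] t //=; rewrite compA. Qed.

(* The alternating sum of all the faces but the one forgetting the initial
   vertex. *)
Fixpoint chain_diff (V : zmodType) p (d : D) :
    (chain p d -> V) -> chain p.+1 d -> V :=
  match p return (chain p d -> V) -> chain p.+1 d -> V with
  | 0 => fun y _ => y tt
  | q.+1 => fun y t =>
      let: existT e (f, u) := t in
      y (@chain_precomp q.+1 d e f u)
      - @chain_diff V q e (fun s => y (chain_cons f s)) u
  end.

Lemma chain_diffS (V : zmodType) p (d e : D)
    (y : chain p.+1 d -> V) (f : mor d e) (t : chain p.+1 e) :
  chain_diff y (chain_cons f t)
  = y (chain_precomp f t) - chain_diff (fun s => y (chain_cons f s)) t.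
Proof. by []. Qed.

Lemma chain_diff_additive (V W : zmodType) p (d : D)
    (F : {additive V -> W}) (y : chain p d -> V) t :
  F (chain_diff y t) = chain_diff (F \o y) t.
Proof.
elim: p d y t => [|p IH] d y t //.
by elim/chainSP: t => e f t; rewrite !chain_diffS raddfB IH.
Qed.

Lemma eq_chain_diff (V : zmodType) p (d : D)
    (y z : chain p d -> V) : y =1 z -> chain_diff y =1 chain_diff z.
Proof. by move=> /funext ->. Qed.

Lemma chain_diffB (V : zmodType) p (d : D)
    (y z : chain p d -> V) t :
  chain_diff (fun s => y s - z s) t = chain_diff y t - chain_diff z t.
Proof.
elim: p d y z t => [|p IH] d y z t //.
elim/chainSP: t => e f t; rewrite !chain_diffS IH.
by rewrite !opprD !opprK addrACA.
Qed.

Lemma chain_diff_linear (R : pzRingType) (V : lmodType R) p (d : D)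
    a (y z : chain p d -> V) t :
  chain_diff (fun s => a *: y s + z s) t = a *: chain_diff y t + chain_diff z t.
Proof.
elim: p d y z t => [|p IH] d y z t //.
elim/chainSP: t => e f t; rewrite !chain_diffS IH.
by rewrite scalerBr opprD addrACA.
Qed.

(** By [chain_diffS] this says that [chain_diff] squares to zero on [chain_cons f t]. *)
Lemma chain_diff_sq (V : zmodType) p (d e : D)
    (y : chain p d -> V) (f : mor d e) (t : chain p.+1 e) :
  chain_diff (fun s => chain_diff y (chain_cons f s)) t
  = chain_diff y (chain_precomp f t).
Proof.
elim: p d e y f t => [|p IH] d e y f t //.
elim/chainSP: t => e' g t; rewrite [RHS]chain_diffS.
under eq_chain_diff => s do rewrite chain_diffS.
(* The subtracted term is the square of [chain_diff] on [fun s => y (chain_cons f s)], zero by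
   induction. *)
rewrite chain_diffB [X in _ - X]chain_diffS IH subrr subr0.
by rewrite chain_diffS chain_precomp_comp.
Qed.

End Chains.

Record complex_presheaf (R : pzRingType) (D : category) := ComplexPresheaf {
  stalk :> D -> cochain_complex R;
  restr : forall d e, mor d e -> cochain_map (stalk e) (stalk d);
  restr_comp : forall a b c (g : mor b c) (f : mor a b) n (x : stalk c n),
    restr (catcomp g f) n x = restr f n (restr g n x) }.

Arguments restr {R D} F {d e} f : rename.

Section ChainCochains.
Variables (R : pzRingType) (D : category) (F : complex_presheaf R D).

(** The cosimplicial replacement of [F], with values at the initial vertex because [F] is
    contravariant. *)
Definition chain_cochain p : cochain_complex R :=
  prod_complex (fun s : {d : D & chain p d} => F (projT1 s)).

Definition starting_at p n (x : chain_cochain p n) (d : D) (t : chain p d) :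
  F d n := x (existT _ d t).

(** Only the face forgetting the initial vertex changes the stalk, hence [restr] on it. The
    remaining faces, beginning with a minus sign, are in [chain_diff]. *)
Definition chain_step_fun p n (x : chain_cochain p n) : chain_cochain p.+1 n :=
  fun s => let: existT d t := s return F (projT1 s) n in
    restr F (projT2 t).1 n (starting_at x (projT2 t).2)
    - chain_diff (@starting_at p n x d) t.

Lemma chain_stepE p n (x : chain_cochain p n) (d e : D) (f : mor d e)
    (t : chain p e) :
  starting_at (chain_step_fun x) (chain_cons f t)
  = restr F f n (starting_at x t) -
    chain_diff (@starting_at p n x d) (chain_cons f t).
Proof. by []. Qed.

Lemma chain_cochain_ext p n (x y : chain_cochain p n) :
  (forall d t, @starting_at p n x d t = @starting_at p n y d t) -> x = y.
Proof. by move=> xy; apply: prod_mod_ext => -[d t]; exact: xy. Qed.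

Fact chain_step_linear p n : linear (@chain_step_fun p n).
Proof.
move=> a x y; apply: chain_cochain_ext => d; elim/chainSP=> e f t.
rewrite -[RHS]/(a *: starting_at (chain_step_fun x) (chain_cons f t)
                + starting_at (chain_step_fun y) (chain_cons f t)) !chain_stepE.
have lin d' : starting_at (a *: x + y) (d := d')
  = fun t => a *: starting_at x t + starting_at y t by [].
by rewrite !lin chain_diff_linear linearP scalerBr opprD addrACA.
Qed.
HB.instance Definition _ p n :=
  GRing.isLinear.Build R (chain_cochain p n) (chain_cochain p.+1 n) _
    (@chain_step_fun p n) (@chain_step_linear p n).

Fact chain_step_diff p n (x : chain_cochain p n) :
  chain_step_fun (differential x) = differential (chain_step_fun x).
Proof.
apply: chain_cochain_ext => d; elim/chainSP=> e f t.
rewrite -[RHS]/(differential (starting_at (chain_step_fun x) (chain_cons f t))).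
by rewrite !chain_stepE linearB -cmap_diff (chain_diff_additive differential).
Qed.

Definition chain_step p : cochain_map (chain_cochain p) (chain_cochain p.+1) :=
  @CochainMap R (chain_cochain p) (chain_cochain p.+1)
    (fun n => @chain_step_fun p n) (@chain_step_diff p).

(** The double restrictions agree by [restr_comp], the mixed terms cancel because [restr] commutes
    with [chain_diff], and the rest is [chain_diff_sq]. *)
Lemma chain_step_step p n (x : chain_cochain p n) :
  chain_step p.+1 n (chain_step p n x) = 0.
Proof.
apply: chain_cochain_ext => d; elim/chainSP=> e f; elim/chainSP=> e' g t.
rewrite /= !chain_stepE [chain_diff _ (chain_cons f _)]chain_diffS.
have -> : (fun s => starting_at (chain_step_fun x) (chain_cons f s))
  = fun s => restr F f n (starting_at x s)
             - chain_diff (@starting_at p n x d) (chain_cons f s) by [].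
rewrite chain_diffB chain_diff_sq [starting_at _ (chain_precomp _ _)]chain_stepE.
rewrite linearB -restr_comp (chain_diff_additive (restr F f n)).
rewrite opprB addrA subrKA; exact: subrr.
Qed.

End ChainCochains.

Section ProductMaps.
Variables (R : pzRingType) (I : Type).

(** Evaluation as a linear map, so that [chain_diff_additive] can move it inside [chain_diff]. *)
Definition prod_eval (V : I -> lmodType R) i (x : prod_mod V) : V i := x i.

Fact prod_eval_linear (V : I -> lmodType R) i : linear (@prod_eval V i).
Proof. by []. Qed.
HB.instance Definition _ (V : I -> lmodType R) i :=
  GRing.isLinear.Build R (prod_mod V) (V i) _ (@prod_eval V i)
    (@prod_eval_linear V i).

Variables (X : cochain_complex R) (K : I -> cochain_complex R).
Variable F : forall i, cochain_map X (K i).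

Definition prod_lift_fun n (x : X n) : prod_complex K n := fun i => F i n x.

Fact prod_lift_linear n : linear (@prod_lift_fun n).
Proof. by move=> a x y; apply: prod_mod_ext => i; exact: linearP. Qed.
HB.instance Definition _ n :=
  GRing.isLinear.Build R (X n) (prod_complex K n) _
    (@prod_lift_fun n) (@prod_lift_linear n).

Fact prod_lift_diff n (x : X n) :
  prod_lift_fun (differential x) = differential (prod_lift_fun x).
Proof. by apply: prod_mod_ext => i; exact: cmap_diff. Qed.

Definition prod_lift : cochain_map X (prod_complex K) :=
  @CochainMap R X (prod_complex K) (fun n => @prod_lift_fun n) prod_lift_diff.

End ProductMaps.

(** * Pullback of cochains with a change of coefficients *)

Section CoefficientChange.
Variables (R : pzRingType) (X Y : simplicial_set) (G : simplicial_map X Y).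
Variables (N : coef_system R X) (N' : coef_system R Y).
Variable theta : rmod_nat (coef_pullback G N') N.

(** Below, every [theta] is the identity on each module: it relates coefficient systems with
    convertible values that differ in the proofs carried by their morphisms. *)
Definition gz_transform n (x : gz_cochain N' n) : gz_cochain N n :=
  fun s => theta (existT _ n s) (x (G n s)).

Fact gz_transform_linear n : linear (@gz_transform n).
Proof. by move=> a x y; apply: prod_mod_ext => s; exact: linearP. Qed.
HB.instance Definition _ n :=
  GRing.isLinear.Build R (gz_cochain N' n) (gz_cochain N n) _
    (@gz_transform n) (@gz_transform_linear n).

Fact gz_transform_natural m n (f : @mor simplex_category m n)
    (x : gz_cochain N' m) :
  gz_transform (gz_act f x) = gz_act f (gz_transform x).
Proof.
apply: prod_mod_ext => s; rewrite /gz_transform.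
rewrite (gz_actE (fmap (simplices_functor G) (simplex_mor f s))).
exact: ncomp_natural.
Qed.

Definition gz_transform_map : cochain_map (gz_complex N') (gz_complex N) :=
  cochain_map_of_cosimplicial
    (@RmodNat R simplex_category (gz_cosimplicial N') (gz_cosimplicial N)
      (fun n => @gz_transform n) gz_transform_natural).

End CoefficientChange.

Lemma mmap_simplices_ext (R : pzRingType) (X : simplicial_set)
    (N : coef_system R X) (s t : simplices X) (f g : mor s t) (v : N s) :
  sval f = sval g -> mmap N f v = mmap N g v.
Proof. by move=> /simplices_mor_ext ->. Qed.

Definition to_last n (i : ordinal_category n) :
  @mor (ordinal_category n) i (@ord_max n) := leq_ord i.

(** * The resolution by the cochains of the comma categories *)

Section Slice.
Variables (C D : category) (phi : functor C D) (d : D).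

(* N(phi/d), with an n-simplex (c_i, mu_i : phi c_i -> d) encoded by the chain
   of the c_i and mu_n.  Pulling coefficients back along the projection to
   nerve C then only involves definitional equalities. *)
Definition slice_simplex n : Type :=
  {s : functor (ordinal_category n) C & mor (phi (s (@ord_max n))) d}.

Lemma slice_simplex_ext n fo fm fm' p q p' q' (m m' : mor (phi (fo ord_max)) d) :
  (forall a b (f : mor a b), fm a b f = fm' a b f) -> m = m' ->
  existT (fun s : functor (ordinal_category n) C => mor (phi (s (@ord_max n))) d)
    (@Functor (ordinal_category n) C fo fm p q) m
  = existT _ (@Functor (ordinal_category n) C fo fm' p' q') m'.
Proof.
move=> e ->; have {}e : fm = fm'.
  by do 3 (apply: functional_extensionality_dep => ?).
by subst fm'; rewrite (Prop_irrelevance p p') (Prop_irrelevance q q').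
Qed.

(** The last vertex of the new simplex is the old vertex $f(m)$, so the morphism to [d] is
    precomposed with the image of $c_{f(m)} \to c_n$. *)
Definition slice_pull m n (f : @mor simplex_category m n) (x : slice_simplex n) :
    slice_simplex m :=
  existT _ (functor_comp (projT1 x) (ordinal_functor f))
    (catcomp (projT2 x)
      (fmap phi (fmap (projT1 x) (to_last (ordinal_functor f (@ord_max m)))))).

Lemma slice_pull_id n (x : slice_simplex n) :
  slice_pull (@idm simplex_category n) x = x.
Proof.
case: x => -[fo fm p q] mu; apply: slice_simplex_ext => [a b f|] /=.
  by congr fm; exact: ordinal_mor_irr.
rewrite (ordinal_mor_irr (to_last _) (@idm (ordinal_category n) _)).
by rewrite p fmap_id comp_idr.
Qed.

Lemma slice_pull_comp m n k (g : @mor simplex_category n k)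
    (f : @mor simplex_category m n) (x : slice_simplex k) :
  slice_pull (catcomp g f) x = slice_pull f (slice_pull g x).
Proof.
apply: slice_simplex_ext => [a b h|] /=.
  by congr (fmap (projT1 x)); exact: ordinal_mor_irr.
rewrite -compA -!fmap_comp; congr (catcomp _ (fmap phi (fmap _ _))).
exact: ordinal_mor_irr.
Qed.

Definition slice : simplicial_set :=
  @SimplicialSet slice_simplex slice_pull slice_pull_id slice_pull_comp.

Definition slice_proj : simplicial_map slice (nerve C) :=
  @SimplicialMap slice (nerve C) (fun n x => projT1 x) (fun m n f x => erefl).

End Slice.

(** * The presheaf of slice cochains and the contraction of its rows *)

Section SlicePresheaf.
Variables (R : pzRingType) (C D : category) (phi : functor C D).
Variable N : coef_system R (nerve C).

Definition slice_coef (d : D) : coef_system R (slice phi d) :=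
  coef_pullback (slice_proj phi d) N.

Definition slice_postcomp_fun (d e : D) (f : mor d e) n (x : slice phi d n) :
  slice phi e n := existT _ (projT1 x) (catcomp f (projT2 x)).

Fact slice_postcomp_pull (d e : D) (f : mor d e) m n
    (g : @mor simplex_category m n) (x : slice phi d n) :
  slice_postcomp_fun f (pull g x) = pull g (slice_postcomp_fun f x).
Proof. by rewrite /slice_postcomp_fun /= /slice_pull /= compA. Qed.

Definition slice_postcomp (d e : D) (f : mor d e) :
    simplicial_map (slice phi d) (slice phi e) :=
  @SimplicialMap (slice phi d) (slice phi e) (@slice_postcomp_fun d e f)
    (@slice_postcomp_pull d e f).

Program Definition slice_restr_nat (d e : D) (f : mor d e) :
    rmod_nat (coef_pullback (slice_postcomp f) (slice_coef e)) (slice_coef d) :=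
  @RmodNat R _ (coef_pullback (slice_postcomp f) (slice_coef e)) (slice_coef d)
    (fun a => idfun) _.
Next Obligation. exact: (@mmap_simplices_ext _ _ N). Qed.

Lemma slice_restr_comp (a b c : D) (g : mor b c) (f : mor a b) n
    (x : gz_complex (slice_coef c) n) :
  gz_transform_map (slice_restr_nat (catcomp g f)) n x
  = gz_transform_map (slice_restr_nat f) n
      (gz_transform_map (slice_restr_nat g) n x).
Proof.
apply: prod_mod_ext => -[s mu] /=; rewrite /gz_transform /=.
by rewrite /slice_postcomp_fun /= compA.
Qed.

Definition slice_presheaf : complex_presheaf R D :=
  @ComplexPresheaf R D (fun d => gz_complex (slice_coef d))
    (fun d e f => gz_transform_map (slice_restr_nat f)) slice_restr_comp.

Local Notation A := (chain_cochain slice_presheaf).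

Definition slice_aug : cochain_map (gz_complex N) (A 0) :=
  prod_lift (fun s : {d : D & chain 0 d} =>
    cochain_map_of_cosimplicial (gz_pullback_nat (slice_proj phi (projT1 s)) N)).

(** The universal slice simplex over [s]: any $(s,\mu)$ is its postcomposition with $\mu$. *)
Definition last_id n (s : nerve C n) : slice phi (phi (fobj s (@ord_max n))) n :=
  existT _ s (idm _).

Lemma slice_postcomp_last_id (d : D) n (x : gz_complex (slice_coef d) n)
    (s : slice phi d n) :
  x (slice_postcomp (projT2 s) n (last_id (projT1 s))) = x s
  :> N (existT _ n (projT1 s)).
Proof. by case: s => s mu; rewrite /= /slice_postcomp_fun /= comp_idr. Qed.

(** The end of the row contraction at the augmentation. It is built for each [n] separately, which
    suffices for exactness in each degree. *)
Definition slice_contract0 n (y : A 0 n) : gz_complex N n :=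
  fun s => starting_at y (tt : chain 0 _) (last_id s).

Definition slice_contract p n (y : A p.+1 n) : A p n :=
  fun s => let: existT d t := s return gz_complex (slice_coef (projT1 s)) n in
    fun m => starting_at y (chain_cons (projT2 m) t) (last_id (projT1 m)).

Lemma slice_aug_inj n (x : gz_complex N n) : slice_aug n x = 0 -> x = 0.
Proof.
move=> x0; apply: prod_mod_ext => s.
exact: (congr1 (fun y : A 0 n =>
  @starting_at _ _ slice_presheaf 0 n y _ tt (last_id s)) x0).
Qed.

Lemma slice_step_aug n (x : gz_complex N n) :
  chain_step slice_presheaf 0 n (slice_aug n x) = 0.
Proof.
apply: chain_cochain_ext => d; elim/chainSP=> e f t.
by rewrite /= chain_stepE; apply: subrr.
Qed.

Lemma slice_aug_exact n (y : A 0 n) :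
  chain_step slice_presheaf 0 n y = 0 -> exists x, y = slice_aug n x.
Proof.
move=> y0; exists (slice_contract0 y); apply: chain_cochain_ext => d [].
apply: prod_mod_ext => s; rewrite -slice_postcomp_last_id; apply: subr0_eq.
(* The condition is read at the 1-chain $\mu : \varphi(c_n) \to d$ and at [last_id]: it equates [y]
   at $(s,\mu)$ with [y] at the universal simplex. *)
exact: (congr1 (fun z : A 1 n => starting_at z
  (chain_cons (projT2 s) (tt : chain 0 d)) (last_id (projT1 s))) y0).
Qed.

Lemma slice_step_exact p n (y : A p.+1 n) :
  chain_step slice_presheaf p.+1 n y = 0 ->
  exists x, y = chain_step slice_presheaf p n x.
Proof.
move=> y0; exists (slice_contract y); apply: chain_cochain_ext => d.
elim/chainSP=> e f t; apply: prod_mod_ext => s.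
(* The condition is read at $\varphi(c_n) \to d \to e \to \dots$ and at [last_id]. The first face
   gives [y] at [s], the second the restriction term of the step of [slice_contract y], and the
   others its [chain_diff]. *)
have := congr1 (fun z : A p.+2 n => starting_at z
  (chain_cons (projT2 s) (chain_cons f t)) (last_id (projT1 s))) y0.
rewrite /= chain_stepE chain_diffS chain_stepE.
set u := chain_diff _ (chain_cons f t); set v := chain_diff _ (chain_cons f t).
have uv : u (last_id (projT1 s)) = v s.
  rewrite -[LHS]/(prod_eval (last_id (projT1 s)) u) -[RHS]/(prod_eval s v).
  rewrite (chain_diff_additive (prod_eval (last_id (projT1 s)))).
  by rewrite (chain_diff_additive (prod_eval s)).
rewrite -[X in X = _]/(starting_at y (chain_cons f t)
    (slice_postcomp (projT2 s) n (last_id (projT1 s))) -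
  (starting_at y (chain_precomp (projT2 s) (chain_cons f t)) (last_id (projT1 s))
   - u (last_id (projT1 s)))) slice_postcomp_last_id uv.
by move=> /subr0_eq.
Qed.

Definition slice_resolution : resolution (gz_complex N) :=
  @Resolution R _ (chain_cochain slice_presheaf) slice_aug
    (chain_step slice_presheaf) slice_aug_inj slice_step_aug
    (@chain_step_step R D slice_presheaf) slice_aug_exact slice_step_exact.

End SlicePresheaf.

Lemma bijective_quasi_iso (R : pzRingType) (K L : cochain_complex R)
    (F : cochain_map K L) : (forall n, bijective (F n)) -> quasi_iso F.
Proof.
move=> bF n; have inj m := bij_inj (bF m).
have surj m (w : L m) : exists z, w = F m z.
  by have [g _ gK] := bF m; exists (g w).
split=> [z z0|w].
  case: n z z0 => [|n] z z0 /=.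
    by move=> Fz; apply: inj; rewrite linear0.
  move=> [y Fz]; have [x yx] := surj _ y; exists x.
  by apply: inj; rewrite cmap_diff -yx.
have [z ->] := surj _ w => dz; exists z; last first.
  by apply/coboundaryP; exists 0; rewrite subrr linear0.
by apply: inj; rewrite cmap_diff dz linear0.
Qed.

Lemma reindex_bijective (S T : Type) (V : T -> Type) (i : S -> T) :
  bijective i ->
  bijective (fun (x : forall t, V t) (s : S) => x (i s)).
Proof.
move=> [i' iK i'K]; apply: inj_surj_bijective => [x y xy|z].
  apply: functional_extensionality_dep => t; rewrite -(i'K t).
  exact: (congr1 (fun f => f (i' t)) xy).
exists (fun t => ecast t (V t) (i'K t) (z (i' t))).
apply: functional_extensionality_dep => s.
move: (i'K (i s)); rewrite iK => e.
by rewrite (Prop_irrelevance e erefl).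
Qed.

Lemma ecast_section (R : pzRingType) (T : Type) (V : T -> lmodType R)
    (z : forall t, V t) (t1 t2 : T) (e : V t1 = V t2) :
  t1 = t2 -> ecast W (W : lmodType R) e (z t1) = z t2.
Proof. by move=> t12; subst t2; rewrite (Prop_irrelevance e erefl). Qed.

(** Transport of a class is reduced to transport of single values along any proof [E], so the
    equality [comma_pullback] is never unfolded. *)
Lemma gz_cast_class (R : pzRingType) (X : simplicial_set)
    (M M' : coef_system R X) (e : M = M') n
    (z : cocycle (gz_complex M) n) (z' : cocycle (gz_complex M') n) :
  (forall (s : X n) (E : M (existT _ n s) = M' (existT _ n s)),
    ecast W (W : lmodType R) E ((val z : gz_cochain M n) s)
    = (val z' : gz_cochain M' n) s) ->
  gz_cast e n (cohomology_class z) = cohomology_class z'.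
Proof.
subst M' => zz' /=; congr cohomology_class; apply: val_inj.
by apply: prod_mod_ext => s; exact: (zz' s erefl).
Qed.

(** * Comparison of the slice with the nerve of the comma category *)

Section CommaSlice.
Variables (C D : category) (phi : functor C D) (d : D).

Definition comma_to_slice_fun n (s : nerve (comma phi d) n) : slice phi d n :=
  existT _ (functor_comp (comma_j phi d) s) (projT2 (fobj s (@ord_max n))).

Fact comma_to_slice_pull m n (f : @mor simplex_category m n)
    (s : nerve (comma phi d) n) :
  comma_to_slice_fun (pull f s) = pull f (comma_to_slice_fun s).
Proof.
apply: slice_simplex_ext => //=.
by rewrite (svalP (fmap s (to_last _))).
Qed.

Definition comma_to_slice : simplicial_map (nerve (comma phi d)) (slice phi d) :=
  @SimplicialMap _ _ comma_to_slice_fun comma_to_slice_pull.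

Local Obligation Tactic := idtac.

(** Morphisms of the comma category force $\mu_k = \mu_n \circ \varphi(c_k \to c_n)$, so $\mu_n$
    determines every $\mu_k$. *)
Program Definition slice_to_comma n (s : slice phi d n) :
    nerve (comma phi d) n :=
  @Functor (ordinal_category n) (comma phi d)
    (fun k => existT _ (fobj (projT1 s) k)
       (catcomp (projT2 s) (fmap phi (fmap (projT1 s) (to_last k)))))
    (fun k l h => exist _ (fmap (projT1 s) h) _) _ _.
Next Obligation.
move=> n s k l h /=; rewrite -compA -!fmap_comp.
by congr (catcomp _ (fmap phi (fmap _ _))); exact: ordinal_mor_irr.
Qed.
Next Obligation. by move=> n s k; apply: comma_mor_ext; exact: fmap_id. Qed.
Next Obligation.
by move=> n s k l m g f; apply: comma_mor_ext; exact: fmap_comp.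
Qed.

Lemma comma_functor_ext (A : category) (c : A -> C)
    (m m' : forall a, mor (phi (c a)) d) fm p q fm' p' q' :
  (forall a, m a = m' a) ->
  (forall a b (h : mor a b), sval (fm a b h) = sval (fm' a b h)) ->
  @Functor A (comma phi d) (fun a => existT _ (c a) (m a)) fm p q
  = @Functor A (comma phi d) (fun a => existT _ (c a) (m' a)) fm' p' q'.
Proof.
move=> mm' e; have {}mm' := functional_extensionality_dep mm'; subst m'.
by apply: functor_congr => a b h; apply: comma_mor_ext.
Qed.

Lemma comma_to_sliceK n : cancel (@comma_to_slice_fun n) (@slice_to_comma n).
Proof.
move=> [so sm p q].
(* Writing the object map as explicit pairs gives both functors the same first components, as
   [comma_functor_ext] demands. *)
have [c [m soE]] : exists c (m : forall k, mor (phi (c k)) d),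
    so = fun k => existT _ (c k) (m k).
  exists (fun k => projT1 (so k)), (fun k => projT2 (so k)).
  by apply: funext => k; rewrite -sigT_eta.
subst so; apply: comma_functor_ext => [k|k l h] //=.
exact: (svalP (sm _ _ (to_last k))).
Qed.

Lemma slice_to_commaK n : cancel (@slice_to_comma n) (@comma_to_slice_fun n).
Proof.
move=> [[so sm p q] mu]; apply: slice_simplex_ext => //=.
rewrite (ordinal_mor_irr (to_last _) (@idm (ordinal_category n) _)).
by rewrite p fmap_id comp_idr.
Qed.

Lemma comma_to_slice_bijective n : bijective (@comma_to_slice_fun n).
Proof.
by exists (@slice_to_comma n); [exact: comma_to_sliceK | exact: slice_to_commaK].
Qed.

Variables (R : pzRingType) (N : coef_system R (nerve C)).

Program Definition comma_to_slice_nat :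
    rmod_nat (coef_pullback comma_to_slice (slice_coef phi N d))
      (th_pullback (comma_j phi d) N) :=
  @RmodNat R _ (coef_pullback comma_to_slice (slice_coef phi N d))
    (th_pullback (comma_j phi d) N) (fun a => idfun) _.
Next Obligation. by move=> a b f x; exact: (@mmap_simplices_ext _ _ N). Qed.

Definition comma_of_slice :
    cochain_map (gz_complex (slice_coef phi N d))
      (gz_complex (th_pullback (comma_j phi d) N)) :=
  gz_transform_map comma_to_slice_nat.

Lemma comma_of_slice_bijective n :
  bijective (cohomology_map comma_of_slice (n := n)).
Proof.
move: n; apply/quasi_isoP; apply: bijective_quasi_iso => n.
exact: (reindex_bijective
  (fun s : slice phi d n => N (existT (nerve C) n (projT1 s)))
  (comma_to_slice_bijective n)).
Qed.

End CommaSlice.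

(** * The map of resolutions induced by the functor *)

Section SliceMap.
Variables (R : pzRingType) (C D : category) (phi : functor C D).
Variable M : coef_system R (nerve D).

Definition slice_image_fun (d : D) n (s : slice phi d n) :
  slice (functor_id D) d n := existT _ (functor_comp phi (projT1 s)) (projT2 s).

Fact slice_image_pull (d : D) m n (f : @mor simplex_category m n)
    (s : slice phi d n) :
  slice_image_fun (pull f s) = pull f (slice_image_fun s).
Proof. exact: slice_simplex_ext. Qed.

Definition slice_image (d : D) :
    simplicial_map (slice phi d) (slice (functor_id D) d) :=
  @SimplicialMap _ _ (@slice_image_fun d) (@slice_image_pull d).

Program Definition slice_image_nat (d : D) :
    rmod_nat (coef_pullback (slice_image d) (slice_coef (functor_id D) M d))
      (slice_coef phi (th_pullback phi M) d) :=
  @RmodNat R _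
    (coef_pullback (slice_image d) (slice_coef (functor_id D) M d))
    (slice_coef phi (th_pullback phi M) d) (fun a => idfun) _.
Next Obligation. exact: (@mmap_simplices_ext _ _ M). Qed.

Definition slice_map (d : D) :
    cochain_map (slice_presheaf (functor_id D) M d)
      (slice_presheaf phi (th_pullback phi M) d) :=
  gz_transform_map (slice_image_nat d).

(** This square carries the hypothesis on [comma_map] over to [slice_map]. *)
Lemma comma_map_slice (d : D) n
    (c : cohomology (slice_presheaf (functor_id D) M d) n) :
  comma_map phi M d n (cohomology_map (comma_of_slice (functor_id D) d M) c)
  = cohomology_map (comma_of_slice phi d (th_pullback phi M))
      (cohomology_map (slice_map d) c).
Proof.
have [z ->] := cohomology_classP c; rewrite !cohomology_mapE.
rewrite /comma_map /thomason_map /gz_map /= cohomology_mapE.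
apply: gz_cast_class => s E.
(* Both composites evaluate [z], at slice simplices that are equal without being convertible. *)
apply: (@ecast_section R (slice (functor_id D) d n)
  (fun t => M (existT (nerve D) n (projT1 t))) (val z)
  (comma_to_slice _ d n (nerve_map (comma_u phi d) n s))
  (slice_image d n (comma_to_slice phi d n s)) E).
exact: slice_simplex_ext.
Qed.

Lemma slice_map_quasi_iso (d : D) :
  (forall n, bijective (comma_map phi M d n)) -> quasi_iso (slice_map d).
Proof.
move=> bM; apply/quasi_isoP => n.
have [g gK Kg] := comma_of_slice_bijective phi d (th_pullback phi M) n.
(* As [g] inverts the comparison for [phi], the square expresses [slice_map] in cohomology as a
   composite of bijections. *)
apply: (@eq_bij _ _ (g \o (comma_map phi M d n \o
  cohomology_map (comma_of_slice (functor_id D) d M) (n := n)))).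
  apply: bij_comp.
    by exists (cohomology_map (comma_of_slice phi d (th_pullback phi M)) (n := n)).
  apply: bij_comp; [exact: bM | exact: comma_of_slice_bijective].
by move=> c; rewrite -[RHS]gK -comma_map_slice.
Qed.

(** True by conversion, thanks to the slice encoding: both sides read [x] at the image of the
    underlying chain. *)
Lemma slice_map_aug n (x : gz_complex M n) :
  aug (slice_resolution phi (th_pullback phi M)) n
    (cochain_map_of_cosimplicial (gz_pullback_nat (nerve_map phi) M) n x)
  = prod_map (fun s : {d : D & chain 0 d} => slice_map (projT1 s)) n
      (aug (slice_resolution (functor_id D) M) n x).
Proof. by []. Qed.

Lemma slice_map_step p n
    (x : chain_cochain (slice_presheaf (functor_id D) M) p n) :
  step (slice_resolution phi (th_pullback phi M)) p n
    (prod_map (fun s : {d : D & chain p d} => slice_map (projT1 s)) n x)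
  = prod_map (fun s : {d : D & chain p.+1 d} => slice_map (projT1 s)) n
      (step (slice_resolution (functor_id D) M) p n x).
Proof.
apply: chain_cochain_ext => d; elim/chainSP=> e f t.
rewrite -[RHS]/(slice_map d n (starting_at (chain_step_fun x) (chain_cons f t))).
by rewrite /= !chain_stepE linearB (chain_diff_additive (slice_map d n)).
Qed.

End SliceMap.

Theorem theorem1p2 (R : comPzRingType) (C D : category) (phi : functor C D)
    (M : coef_system R (nerve D)) :
  (forall (d : D) (n : nat), bijective (comma_map phi M d n)) ->
  forall n : nat, bijective (thomason_map phi M n).
Proof.
(* [thomason_map] unfolds to the [cohomology_map] of the pullback of cochains. *)
move=> bM; apply/quasi_isoP.
apply: (@quasi_iso_resolution R _ _ _ (slice_resolution (functor_id D) M)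
  (slice_resolution phi (th_pullback phi M))
  (fun p => prod_map (fun s : {d : D & chain p d} => slice_map phi M (projT1 s)))).
- exact: slice_map_aug.
- exact: slice_map_step.
by move=> p; apply: prod_quasi_iso => -[d t]; apply: slice_map_quasi_iso.
Qed.
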